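(* Let $q\ge2$, $n\ge1$, and let $\boldsymbol{x},\boldsymbol{y}\in\mathbb{Z}_q^n$ be two distinct $2$-palindrome free words, i.e. $S^{\rho^D_2}_1(\boldsymbol{x})=S^{\rho^D_2}_1(\boldsymbol{y})=\emptyset$. Then \[S^{\rho_\ell}_1(\boldsymbol{x})\cap S^{\rho_\ell}_1(\boldsymbol{y})=\emptyset\] for all $\ell\ge2$.
   Context: Palindromic duplication of length $\ell$ at position $p$ ($0\le p\le|\boldsymbol{x}|-\ell$): if $\boldsymbol{x}=(\boldsymbol{u}\boldsymbol{v}\boldsymbol{w})$ with $|\boldsymbol{u}|=p$, $|\boldsymbol{v}|=\ell$, then $\rho_\ell(\boldsymbol{x},p)=(\boldsymbol{u}\boldsymbol{v}\boldsymbol{v}^{\mathrm R}\boldsymbol{w})$, where $\boldsymbol{v}^{\mathrm R}$ is the reversal of $\boldsymbol{v}$. Palindromic deletion of length $\ell$ at position $p$ ($0\le p\le|\boldsymbol{x}|-2\ell$): defined only if $\boldsymbol{x}=(\boldsymbol{u}\boldsymbol{v}\boldsymbol{v}^{\mathrm R}\boldsymbol{w})$ with $|\boldsymbol{u}|=p$, $|\boldsymbol{v}|=\ell$, and then $\rho^D_\ell(\boldsymbol{x},p)=(\boldsymbol{u}\boldsymbol{v}\boldsymbol{w})$. For $\epsilon\in\{\rho_\ell,\rho_\ell^D\}$, $S^\epsilon_1(\boldsymbol{x})$ is the set of all words $\epsilon(\boldsymbol{x},p)$ over all positions $p$ where the operation is defined. A word is $\ell$-palindrome free if $S^{\rho^D_\ell}_1(\boldsymbol{x})=\emptyset$.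 *)

(* Defs.v *)
From mathcomp Require Import all_boot all_algebra.
From mathcomp Require Import classical_sets.

Set Implicit Arguments.
Unset Strict Implicit.
Unset Printing Implicit Defensive.

Local Open Scope classical_set_scope.

(* Words over T are sequences, and the partial operations return None where   *)
(* they are undefined.  The position ranges 0 <= p <= |x| - l and             *)
(* 0 <= p <= |x| - 2l are written without subtraction, since nat subtraction  *)
(* truncates: no position is allowed when x is too short.                     *)

Definition pal_dup (T : eqType) (l : nat) (x : seq T) (p : nat) :
    option (seq T) :=
  let u := take p x in
  let v := take l (drop p x) in
  let w := drop (p + l) x in
  if p + l <= size x then Some (u ++ v ++ rev v ++ w) else None.

Definition pal_del (T : eqType) (l : nat) (x : seq T) (p : nat) :
    option (seq T) :=
  let u := take p x in
  let v := take l (drop p x) in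
  let v' := take l (drop (p + l) x) in
  let w := drop (p + l.*2) x in
  if (p + l.*2 <= size x) && (v' == rev v) then Some (u ++ v ++ w) else None.

Definition S1 (T : eqType) (eps : seq T -> nat -> option (seq T)) (x : seq T) :
    set (seq T) :=
  [set z | exists p, eps x p = Some z].

Definition pal_free (T : eqType) (l : nat) (x : seq T) : Prop :=
  S1 (pal_del l) x = set0.

Lemma pal_dupP (T : eqType) (l : nat) (x : seq T) (p : nat) (z : seq T) :
  pal_dup l x p = Some z <->
  exists u v w : seq T,
    [/\ x = u ++ v ++ w, size u = p, size v = l & z = u ++ v ++ rev v ++ w].
Proof.
rewrite /pal_dup; split=> [|[u [v [w [-> <- <- ->]]]]].
  case: ifP => // le_pl [<-].
  exists (take p x), (take l (drop p x)), (drop (p + l) x); split=> //.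
  - by rewrite addnC -drop_drop !cat_take_drop.
  - by rewrite size_takel // (leq_trans (leq_addr l p)).
  - by rewrite size_takel // size_drop leq_subRL // (leq_trans (leq_addr l p)).
rewrite !size_cat addnA leq_addr take_size_cat // drop_size_cat //.
by rewrite take_size_cat // addnC -drop_drop !drop_size_cat.
Qed.

Lemma pal_delP (T : eqType) (l : nat) (x : seq T) (p : nat) (z : seq T) :
  pal_del l x p = Some z <->
  exists u v w : seq T,
    [/\ x = u ++ v ++ rev v ++ w, size u = p, size v = l & z = u ++ v ++ w].
Proof.
have drop1 : drop (p + l) x = drop l (drop p x) by rewrite drop_drop addnC.
have drop2 : drop (p + l.*2) x = drop l (drop l (drop p x)).
  by rewrite !drop_drop addnn addnC.
rewrite /pal_del drop1 drop2; split=> [|[u [v [w [def_x sz_u sz_v ->]]]]].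
  case: ifP => // /andP[le_pl /eqP def_v'] [<-].
  have le_p : p + l <= size x.
    by rewrite (leq_trans _ le_pl) // -addnn addnA leq_addr.
  exists (take p x), (take l (drop p x)), (drop l (drop l (drop p x))); split=> //.
  - by rewrite -def_v' !cat_take_drop.
  - by rewrite size_takel // (leq_trans (leq_addr l p)).
  - by rewrite size_takel // size_drop leq_subRL // (leq_trans (leq_addr l p)).
rewrite def_x take_size_cat // (drop_size_cat _ sz_u) take_size_cat //.
rewrite (drop_size_cat _ sz_v) take_size_cat ?size_rev // eqxx andbT.
rewrite drop_size_cat ?size_rev //.
by rewrite !size_cat size_rev sz_u sz_v -addnn !addnA leq_addr.
Qed.

(* Main.v *)
Require Import Defs.
From mathcomp Require Import all_boot all_algebra.
From mathcomp Require Import classical_sets.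
From mathcomp Require Import zify.

Local Open Scope classical_set_scope.

(** Suppose duplications of [x] and [y] produce the same word [z], with
    palindromes of length [2 l] centred at [i <= j].  If [i = j] then [x = y].
    If [j >= i + 2], then [y], which agrees with [z] before [j], contains the
    four middle letters of the palindrome centred at [i], so it is not
    2-palindrome free.  If [j = i + 1], composing the two reflections shows that
    [z] is constant from [i] to [i + l]; as [x] and [y] can differ only at
    position [i], where they carry the letters [z_(i + l)] and [z_i], again
    [x = y]. *)

Lemma nth_pal_dup_lt (T : eqType) (x0 : T) (l p : nat) (x z : seq T) (k : nat) :
  pal_dup l x p = Some z -> k < p + l -> nth x0 x k = nth x0 z k.
Proof.
move=> /pal_dupP[u [v [w [-> szu szv ->]]]] lt_k.
by rewrite !catA -(catA (u ++ v)) !(nth_cat _ (u ++ v)) size_cat szu szv lt_k.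
Qed.

(** The inserted [rev v] pushes [w] right by [l]. *)
Lemma nth_pal_dup_ge (T : eqType) (x0 : T) (l p : nat) (x z : seq T) (k : nat) :
  pal_dup l x p = Some z -> p + l <= k -> nth x0 x k = nth x0 z (k + l).
Proof.
move=> /pal_dupP[u [v [w [-> szu szv ->]]]] le_k.
rewrite !catA !nth_cat !size_cat size_rev szu szv.
by do ![case: ifP => ? //; try lia]; congr nth; lia.
Qed.

Lemma nth_pal_dup_sym (T : eqType) (x0 : T) (l p : nat) (x z : seq T) (k : nat) :
  pal_dup l x p = Some z -> k < l ->
  nth x0 z (p + l + k) = nth x0 z (p + l - k.+1).
Proof.
move=> /pal_dupP[u [v [w [_ szu szv ->]]]] lt_kl.
rewrite !nth_cat size_rev szu szv.
do ![case: ifP => ?; try lia].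
by rewrite nth_rev ?szv; [congr nth|]; lia.
Qed.

Lemma pal_dup_leq (T : eqType) (l p : nat) (x z : seq T) :
  pal_dup l x p = Some z -> p + l <= size x.
Proof. by rewrite /pal_dup; case: ifP. Qed.

Lemma pal_free2_nth (T : eqType) (x0 : T) (x : seq T) (k : nat) :
  pal_free 2 x -> k + 4 <= size x ->
  nth x0 x (k + 2) = nth x0 x (k + 1) -> nth x0 x (k + 3) = nth x0 x k -> False.
Proof.
move=> free_x le_k eq_mid eq_ext.
suff : S1 (pal_del 2) x (take k x ++ take 2 (drop k x) ++ drop (k + 4) x).
  by rewrite free_x.
have take2 j : j + 1 < size x ->
    take 2 (drop j x) = [:: nth x0 x j; nth x0 x (j + 1)].
  move=> lt_j; rewrite addn1 in lt_j *.
  by rewrite (drop_nth x0 (ltnW lt_j)) (drop_nth x0 lt_j) /= take0.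
exists k; rewrite /pal_del le_k !take2; try lia.
by rewrite /rev /= -addnA eq_mid eq_ext eqxx.
Qed.

Lemma pal_dup_adjacent (T : eqType) (x0 : T) (l p : nat) (x y z : seq T) (k : nat) :
  pal_dup l x p = Some z -> pal_dup l y p.+1 = Some z -> k <= l ->
  nth x0 z (p + l + k) = nth x0 z (p + l).
Proof.
move=> dup_x dup_y.
elim/ltn_ind: k => -[|[|k]] IHk le_kl; first by rewrite addn0.
  have := nth_pal_dup_sym _ x0 _ _ _ _ 0 dup_y le_kl.
  by rewrite addn0 subn1 /= => <-; congr nth; lia.
(* Reflecting offset [k + 2] about the centre of [y], then about that of [x], gives offset [k]: the
   induction moves by two, hence its two base cases. *)
rewrite -(IHk k) //; last by lia.
rewrite (nth_pal_dup_sym _ x0 _ _ _ _ k dup_x (ltnW le_kl)).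
have := nth_pal_dup_sym _ x0 _ _ _ _ k.+1 dup_y le_kl.
by rewrite addSn subSS addSnnS.
Qed.

(** As [p <= p'], it is [y] that keeps the longer prefix of [z], so the forbidden palindrome is
    sought in [y]. *)
Lemma pal_dup_inj (T : eqType) (l p p' : nat) (x y z : seq T) :
  2 <= l -> size x = size y -> pal_free 2 y -> p <= p' ->
  pal_dup l x p = Some z -> pal_dup l y p' = Some z -> x = y.
Proof.
move=> le2l eq_sz free_y le_pp' dup_x dup_y.
have le_p'y := pal_dup_leq _ _ _ _ _ dup_y.
(* The first letter of [x] serves as the default for [nth]. *)
case: x => [|x0 x] in eq_sz dup_x *; first by case: y eq_sz {free_y dup_y le_p'y}.
have lt_y := nth_pal_dup_lt _ x0 _ _ _ _ _ dup_y.
have ge_y := nth_pal_dup_ge _ x0 _ _ _ _ _ dup_y.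
have lt_x := nth_pal_dup_lt _ x0 _ _ _ _ _ dup_x.
have ge_x := nth_pal_dup_ge _ x0 _ _ _ _ _ dup_x.
have [ge2|lt2] := leqP p.+2 p'.
  have sym_x := nth_pal_dup_sym _ x0 _ _ _ _ _ dup_x.
  (* The four letters around the centre [p + l] end at [p + l + 1 < p' + l], inside the prefix that
     [y] shares with [z]. *)
  exfalso; apply: (pal_free2_nth _ x0 y (p + l - 2) free_y); first by lia.
    rewrite !lt_y; try lia.
    by have := sym_x 0 (ltnW le2l); congr (nth _ _ _ = nth _ _ _); lia.
  rewrite !lt_y; try lia.
  by have := sym_x 1 le2l; congr (nth _ _ _ = nth _ _ _); lia.
apply: (eq_from_nth (x0 := x0)) => // k _.
have [lt_k|ge_k] := ltnP k (p + l); first by rewrite lt_x // lt_y //; lia.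
rewrite ge_x //.
have [ge_k'|lt_k'] := leqP (p' + l) k; first by rewrite ge_y.
(* Now [p + l <= k < p' + l] with [p' <= p + 1], which leaves one position. *)
have -> : k = p + l by lia.
rewrite lt_y; last by lia.
have def_p' : p' = p.+1 by lia.
by rewrite def_p' in dup_y; apply: pal_dup_adjacent dup_x dup_y _.
Qed.

Theorem lemma6 (q n : nat) (hq : 2 <= q) (hn : 1 <= n)
    (x y : n.-tuple 'Z_q) (hxy : x <> y)
    (hx : pal_free 2 x) (hy : pal_free 2 y) :
  forall l : nat, 2 <= l -> S1 (pal_dup l) x `&` S1 (pal_dup l) y = set0.
Proof.
move=> l le2l; rewrite -subset0 => z [[p dup_x] [p' dup_y]].
apply: hxy; apply: val_inj => /=.
have [le_pp'|/ltnW le_p'p] := leqP p p'.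
  by apply: pal_dup_inj le_pp' dup_x dup_y; rewrite ?size_tuple.
by apply/esym; apply: pal_dup_inj le_p'p dup_y dup_x; rewrite ?size_tuple.
Qed.
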